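(* Let $K$ be a $k$-dimensional cubical complex which admits an embedding, or more generally a non-degenerate map, into $\{\mathbb{R}^n\}_{(k)}$ for some $n$, where $\{\mathbb{R}^n\}_{(k)}$ is the $k$-dimensional skeleton of the standard cubical decomposition $\{\mathbb{R}^n\}=\{\mathbb{R}^1\}^n$ of $\mathbb{R}^n$. Then $\Pi(K,\sigma)\subset BC_k^{even}$ for each $k$-dimensional cube $\sigma\in K$. Moreover, if $\sigma\in L\subset K$ where $L$ is a subcomplex of $K$ isomorphic to $\{I^{k+1}\}_{(k)}$, the $k$-skeleton of the standard $(k+1)$-dimensional cube, then \[ \Pi(K,\sigma)\cong BC_k^{even}. \]
   Context: Here $k\ge 1$. A poset $P$ is cubical if (a) for each $x\in P$ the subposet $P_{\le x}$ is isomorphic to the face poset (of non-empty faces) of some cube $I^q$, and (b) whenever a pair $x,y\in P$ is bounded from above it has a least upper bound. A cubical complex $K$ is a regular CW-complex whose face poset $P_K$ is cubical. A map of cubical complexes $f:K\to L$ is non-degenerate (a ''combinatorial immersion'', and $K$ is ''mappable'' to $L$) if it is given by a monotone map $f:P_K\to P_L$ which for each $x\in P_K$ restricts to an isomorphism of posets $(P_K)_{\le x}\to (P_L)_{\le f(x)}$; an embedding is an injective non-degenerate map. The standard cubical decomposition $\{\mathbb{R}^1\}$ has the integers as vertices and the intervals $[i,i+1]$, $i\in\mathbb{Z}$, as edges; $\{\mathbb{R}^n\}$ is the product decomposition. $\{I^{d}\}$ is the standard $d$-cube with all its faces, and a subscript $(k)$ denotes the $k$-skeleton. Groupoid and holonomy: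 for a $k$-dimensional cubical complex $K$, the groupoid $\mathcal{E}(K)$ has as objects the $k$-dimensional cubes of $K$, each cube $\sigma$ being identified with its face poset $(P_K)_{\le\sigma}$. If $\sigma_1,\sigma_2$ have a common $(k-1)$-dimensional face $\delta$, an elementary morphism from $\sigma_1$ to $\sigma_2$ is an isomorphism of face posets $\sigma_1\to\sigma_2$ which fixes $\delta$ and all its faces. A morphism from $\sigma$ to $\sigma'$ is an isomorphism of face posets $\sigma\to\sigma'$ which is a composition of elementary morphisms. The holonomy group is $\Pi(K,\sigma):=\mathcal{E}(K)(\sigma,\sigma)$, a subgroup of the group of all automorphisms (symmetries) of the cube $\sigma$. $BC_k$ is the group of all symmetries of a $k$-cube, identified with the group of all signed permutation $(k\times k)$-matrices (a symmetry is represented by its linear part acting on the coordinate directions). $BC_k^{even}$ is its subgroup of all matrices with an even number of $(-1)$-entries. The symmetry group of $\sigma$ is identified with $BC_k$ via any isomorphism $\sigma\cong I^k$; since $BC_k^{even}$ is normal, the condition $\Pi(K,\sigma)\subset BC_k^{even}$ does not depend on this choice. *)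

(* Defs.v *)
From HB Require Import structures.
From mathcomp Require Import all_boot all_order all_fingroup all_algebra.
From mathcomp Require Import boolp classical_sets functions.

Set Implicit Arguments.
Unset Strict Implicit.
Unset Printing Implicit Defensive.

Import Order.TTheory GRing.Theory Num.Theory.

Local Open Scope order_scope.
Local Open Scope classical_set_scope.

(* A regular CW-complex is determined by its poset of (non-empty, closed) cells
   and every cubical poset is the face poset of such a complex, so a cubical
   complex K is represented by its face poset P_K, a map of cubical complexes by
   the underlying map of posets, and a subcomplex by its set of cells. *)

HB.instance Definition _ d (P : porderType d) (A : set P) :=
  SubChoice.on (set_type A).
HB.instance Definition _ d (P : porderType d) (A : set P) :=
  [SubChoice_isSubPOrder of set_type A by <: with d].

Section Posets.
Context {d d' : Order.disp_t} {P : porderType d} {Q : porderType d'}.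

Definition poset_iso (g : P -> Q) : Prop :=
  bijective g /\ {mono g : x y / x <= y}.

Definition lower (x : P) : set P := [set y | y <= x].

End Posets.

Definition isomorphic d d' (P : porderType d) (Q : porderType d') : Prop :=
  exists g : P -> Q, poset_iso g.

(* The faces of I^1 = [0, 1]: None is the edge, Some false and Some true are the
   vertices 0 and 1. *)
Definition iface : Type := option bool.

HB.instance Definition _ := Choice.on iface.

Definition iface_le (x y : iface) : bool := (x == y) || (y == None).

Fact iface_display : Order.disp_t. Proof. exact: Order.Disp tt tt. Qed.

Fact iface_le_refl : reflexive iface_le.
Proof. by case=> [[]|]. Qed.

Fact iface_le_anti : antisymmetric iface_le.
Proof. by case=> [[]|] [[]|]. Qed.

Fact iface_le_trans : transitive iface_le.
Proof. by case=> [[]|] [[]|] [[]|]. Qed.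

HB.instance Definition _ := Order.Le_isPOrder.Build iface_display iface
  iface_le_refl iface_le_anti iface_le_trans.

(* The cells of {R^1}: (i, b) is the interval [i, i + b], i.e. the vertex i if b
   is false and the edge [i, i + 1] if b is true; cells are ordered by
   inclusion. *)
Definition line : Type := (int * bool)%type.

HB.instance Definition _ := Choice.on line.

Definition line_le (x y : line) : bool :=
  ((y.1 <= x.1) && (x.1 + x.2%:Z <= y.1 + y.2%:Z))%R.

Fact line_display : Order.disp_t. Proof. exact: Order.Disp tt tt. Qed.

Fact line_le_refl : reflexive line_le.
Proof. by move=> x; rewrite /line_le !lexx. Qed.

Fact line_le_anti : antisymmetric line_le.
Proof.
case=> [i b] [j c]; rewrite /line_le /=.
move=> /andP[/andP[ji ibjc] /andP[ij jcib]].
have eij : i = j by apply/eqP; rewrite eq_le ij ji.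
move: ibjc jcib; rewrite eij !lerD2l => bc cb; congr (_, _).
by move: b c bc cb {ij ji} => [] [].
Qed.

Fact line_le_trans : transitive line_le.
Proof.
move=> y x z /andP[yx xy] /andP[zy yz].
by rewrite /line_le (le_trans zy yx) (le_trans xy yz).
Qed.

HB.instance Definition _ := Order.Le_isPOrder.Build line_display line
  line_le_refl line_le_anti line_le_trans.

(* Cells of a product are products of cells, ordered componentwise: this is the
   order boolp puts on function types. *)
Definition cube (q : nat) : Type := 'I_q -> iface.
Definition grid (n : nat) : Type := 'I_n -> line.

HB.instance Definition _ q := Order.POrder.on (cube q).
HB.instance Definition _ n := Order.POrder.on (grid n).

Section CubicalComplexes.
Context {d : Order.disp_t}.
Implicit Type P : porderType d.

Definition has_dim P (q : nat) (x : P) : Prop := isomorphic (cube q) (lower x).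

Definition is_lub P (x y l : P) : Prop :=
  [/\ x <= l, y <= l & forall w, x <= w -> y <= w -> l <= w].

Definition cubical P : Prop :=
  (forall x : P, exists q, has_dim q x) /\
  (forall x y z : P, x <= z -> y <= z -> exists l, is_lub x y l).

Definition dimensional (k : nat) P : Prop :=
  (forall (x : P) q, has_dim q x -> (q <= k)%N) /\ (exists x : P, has_dim k x).

Definition skeleton (k : nat) P : set P :=
  [set x | exists2 q, (q <= k)%N & has_dim q x].

Definition subcomplex P (L : set P) : Prop :=
  forall x y, y <= x -> L x -> L y.

End CubicalComplexes.

Definition nondegenerate_map d d' (P : porderType d) (Q : porderType d')
    (f : P -> Q) : Prop :=
  {homo f : x y / x <= y} /\
  forall x, exists2 g : lower x -> lower (f x),
    poset_iso g & forall u, val (g u) = f (val u).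

Section Holonomy.
Context {d : Order.disp_t} {K : porderType d} (k : nat).

Definition elementary (s t : K) (g : lower s -> lower t) : Prop :=
  poset_iso g /\
  exists delta : K, [/\ has_dim k.-1 delta, delta <= s, delta <= t
    & forall u, val u <= delta -> val (g u) = val u].

Inductive groupoid_morphism (s : K) :
    forall t : K, (lower s -> lower t) -> Prop :=
| groupoid_id : has_dim k s -> groupoid_morphism (fun u : lower s => u)
| groupoid_comp t t' (g : lower s -> lower t) (h : lower t -> lower t') :
    groupoid_morphism g -> has_dim k t' -> elementary h ->
    groupoid_morphism (h \o g).

Definition holonomy (s : K) : set (lower s -> lower s) :=
  [set g | groupoid_morphism g].

End Holonomy.

Arguments holonomy {d K} k s.
Arguments skeleton {d} k P.
Arguments dimensional {d} k P.

Section SignedPermutations.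
Local Open Scope ring_scope.

Definition BC (k : nat) : set 'M[int]_k :=
  [set A | exists (e : 'I_k -> bool) (s : 'S_k),
     A = diag_mx (\row_i (-1) ^+ e i) *m perm_mx s].

Definition BC_even (k : nat) : set 'M[int]_k :=
  [set A | @BC k A /\
     ~~ odd #|[pred ij : 'I_k * 'I_k | A ij.1 ij.2 == -1]|].

(* The barycentre of a face, in the coordinates where the cube is [-1, 1]^k. *)
Definition barycentre (k : nat) (F : cube k) : 'cV[int]_k :=
  \col_i (if F i is Some b then (if b then 1 else -1) else 0).

(* In these coordinates the symmetries of the cube are linear and carry
   barycentres of faces to barycentres of faces.  Hence A is the matrix of the
   symmetry phi^-1 \o g \o phi iff it acts on barycentres in the same way; it is
   determined by this, since the facets x_i = 1 have as barycentres the
   vectors of the standard basis. *)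
Definition symmetry_mx d (K : porderType d) k (s : K) (phi : cube k -> lower s)
    (g : lower s -> lower s) (A : 'M[int]_k) : Prop :=
  forall F G : cube k, g (phi F) = phi G -> barycentre G = A *m barycentre F.

End SignedPermutations.

Arguments BC k : clear implicits.
Arguments BC_even k : clear implicits.

Definition group_isomorphic T U (mulT : T -> T -> T) (A : set T)
    (mulU : U -> U -> U) (B : set U) : Prop :=
  exists2 Phi : T -> U, set_bij A B Phi &
    forall x y, A x -> A y -> Phi (mulT x y) = mulU (Phi x) (Phi y).

(* Main.v *)
(* Colour a vertex v of K by the parity of the sum of the coordinates of f v.
   The two ends of an edge get different colours, so a proper colouring of the
   vertices of a cube is known once one of its values is.  An elementary
   morphism fixes a vertex of the common face and hence preserves colours, and
   so does every element of the holonomy group; but a signed permutation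
   preserves the colours of the vertices of I^k exactly when its number of
   signs -1 is even.

   Conversely, in the boundary of I^(k+1) a loop of elementary morphisms
   {x_i = c} -> {x_j = 0} -> {x_l = b} -> {x_i = c} transposes the coordinates j
   and l of the facet {x_i = c}, reversing both of them when b = 1.  These
   symmetries generate BC_k^even. *)
Require Import Defs.
From mathcomp Require Import all_boot all_order all_fingroup all_algebra.
From mathcomp Require Import boolp classical_sets functions.

Set Implicit Arguments.
Unset Strict Implicit.
Unset Printing Implicit Defensive.

Import Order.TTheory GRing.Theory Num.Theory.

Local Open Scope classical_set_scope.

Definition elem T (A : set T) (x : T) (Ax : A x) : A := exist _ x (mem_set Ax).

(** * Parametrisations of the faces below a cell *)

Section Charts.
Local Open Scope order_scope.

(** An isomorphism from [Q] onto [lower x], recorded as a map into [P] itself. Charts of faces then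
    arise by plain composition, with no membership proofs to carry along. *)
Definition chart d d' (Q : porderType d) (P : porderType d') (x : P)
    (T : Q -> P) : Prop :=
  {mono T : F G / F <= G} /\ forall y, y <= x <-> exists F, T F = y.

Lemma mono_le_inj d d' (Q : porderType d) (P : porderType d') (T : Q -> P) :
  {mono T : F G / F <= G} -> injective T.
Proof. by move=> mT F G e; apply/le_anti; rewrite -!mT e lexx. Qed.

Lemma bijectiveP T U (g : T -> U) :
  injective g -> (forall y, exists x, g x = y) -> bijective g.
Proof.
move=> inj_g /choice[h gh]; exists h => // x; exact/inj_g/gh.
Qed.

Lemma chart_iso d d' (Q : porderType d) (P : porderType d') (x : P)
    (T : Q -> P) : chart x T ->
  exists2 phi : Q -> lower x, poset_iso phi & forall F, val (phi F) = T F.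
Proof.
move=> [mT im_T].
have Tx F : lower x (T F) by apply/im_T; exists F.
exists (fun F => elem (Tx F)) => //; split.
  apply: bijectiveP => [F G [/(mono_le_inj mT)]//|u].
  have [F TF] := (im_T (val u)).1 (set_valP u).
  by exists F; apply/val_inj.
by move=> F G; rewrite leEsub /= mT.
Qed.

Lemma iso_chart d d' (Q : porderType d) (P : porderType d') (x : P)
    (phi : Q -> lower x) : poset_iso phi -> chart x (val \o phi).
Proof.
move=> [[psi _ phiK] m]; split=> [F G|y]; first by rewrite /= -m leEsub.
split=> [yx|[F <-]]; last exact: (set_valP (phi F)).
by exists (psi (elem (yx : lower x y))); rewrite /= phiK.
Qed.

Lemma has_dimP d (P : porderType d) q (x : P) :
  has_dim q x <-> exists T : cube q -> P, chart x T.
Proof.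
split=> [[phi /iso_chart phi_chart]|[T /chart_iso[phi phi_iso _]]].
  by exists (val \o phi).
by exists phi.
Qed.

Lemma chart_comp d d' d'' (Q : porderType d) (Q' : porderType d')
    (P : porderType d'') (x : P) (F : Q') (T : Q' -> P) (S : Q -> Q') :
  chart x T -> chart F S -> chart (T F) (T \o S).
Proof.
move=> [mT imT] [mS imS]; split=> [G H|y] /=; first by rewrite mT mS.
split=> [yTF|[G <-]].
  have [|G TG] := (imT y).1.
    by apply: le_trans yTF _; apply/imT; exists F.
  by move: yTF; rewrite -TG mT => /imS[H <-]; exists H.
by rewrite mT; apply/imS; exists G.
Qed.

Lemma iso_can d d' (P : porderType d) (Q : porderType d') (g : P -> Q) :
  poset_iso g -> exists h, [/\ poset_iso h, cancel g h & cancel h g].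
Proof.
move=> [[h gK hK] m]; exists h; split=> //; split; first by exists g.
by move=> x y; rewrite -m !hK.
Qed.

Lemma iso_comp d d' d'' (P : porderType d) (Q : porderType d')
    (R : porderType d'') (h : Q -> R) (g : P -> Q) :
  poset_iso h -> poset_iso g -> poset_iso (h \o g).
Proof.
move=> [bh mh] [bg mg]; split; first exact: bij_comp.
by move=> x y; rewrite /= mh mg.
Qed.

End Charts.

(** * Faces and automorphisms of the cube, and uniqueness of dimension *)

Section Cubes.
Local Open Scope order_scope.

Lemma cube_leP q (F G : cube q) :
  reflect (forall i b, G i = Some b -> F i = Some b) (F <= G).
Proof.
apply: (iffP (lefP _ _)) => FG i.
  by move=> b Gi; move: (FG i); rewrite Gi => /orP[/eqP|].
by case Gi: (G i) => [b|]; [rewrite (FG _ _ Gi)|apply/orP; right].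
Qed.

Definition facet q (i : 'I_q) (b : bool) : cube q :=
  fun j => if j == i then Some b else None.

Lemma le_facet q (F : cube q) i b : (F <= facet i b) = (F i == Some b).
Proof.
apply/cube_leP/eqP => [|Fi j c]; first by apply; rewrite /facet eqxx.
by rewrite /facet; case: eqP => // -> <-.
Qed.

(** Coordinate [i] of the result reads coordinate [p i] of [F]. This is the convention by which
    [perm_mx p] acts on column vectors. *)
Definition cube_act q (e : 'I_q -> bool) (p : 'S_q) (F : cube q) : cube q :=
  fun i => omap (addb (e i)) (F (p i)).

Lemma cube_act_comp q e e' (p p' : 'S_q) F :
  cube_act e p (cube_act e' p' F) = cube_act (fun i => e i (+) e' (p i)) (p * p')%g F.
Proof.
apply/funext => i; rewrite /cube_act permM; case: (F _) => //= b.
by rewrite addbA.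
Qed.

Lemma cube_act1 q (F : cube q) : cube_act (fun=> false) 1%g F = F.
Proof. by apply/funext => i; rewrite /cube_act perm1; case: (F i). Qed.

Lemma cube_act_iso q (e : 'I_q -> bool) (p : 'S_q) : poset_iso (cube_act e p).
Proof.
split.
  exists (cube_act (fun i => e (p^-1%g i)) p^-1%g) => F; rewrite cube_act_comp -[RHS]cube_act1.
    by rewrite mulVg; congr cube_act; apply/funext => i; rewrite addbb.
  by rewrite mulgV; congr cube_act; apply/funext => i; rewrite permK addbb.
move=> F G; apply/cube_leP/cube_leP => FG i b.
  move=> Gi; have := FG ((p^-1)%g i) (e ((p^-1)%g i) (+) b).
  rewrite /cube_act permKV Gi /= => /(_ erefl).
  by case: (F i) => [c|] //= [] /addbI ->.
rewrite /cube_act; case Gi: (G _) => [c|] //= [<-].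
by rewrite (FG _ _ Gi).
Qed.

(** An automorphism fixes the top cell, and the facets are the maximal elements among the remaining
    cells. *)
Lemma facet_auto q (a : cube q -> cube q) i b : poset_iso a ->
  exists j c, a (facet i b) = facet j c.
Proof.
move=> a_iso; have [a' [[_ ma'] aK a'K]] := iso_can a_iso.
have [_ ma] := a_iso.
pose top : cube q := fun=> None.
have notop F : F <> top -> exists j c, F <= facet j c.
  move=> Ftop; apply: contrapT => noF; apply/Ftop/funext => j.
  case Fj: (F j) => [c|//]; case: noF; exists j, c; by rewrite le_facet Fj.
have letop F : F <= top by apply/cube_leP.
have atop : a top = top by apply/le_anti; rewrite letop -{1}(a'K top) ma letop.
have a'top : a' top = top by rewrite -{1}atop aK.
have ftop j c : facet j c <> top :> cube q.
  by move=> /(congr1 (@^~ j)); rewrite /facet eqxx.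
have [j [c le1]] : exists j c, a (facet i b) <= facet j c.
  by apply: notop => afi; apply: (ftop i b); rewrite -(aK (facet i b)) afi.
exists j, c.
have [l [e le2]] : exists l e, a' (facet j c) <= facet l e.
  by apply: notop => afi; apply: (ftop j c); rewrite -(a'K (facet j c)) afi.
have le3 : facet i b <= a' (facet j c) by rewrite -ma a'K.
have := le_trans le3 le2; rewrite le_facet {1}/facet.
case: (altP (l =P i)) => // il /eqP[be]; apply/le_anti; rewrite le1.
by rewrite -(a'K (facet j c)) ma -il be le2.
Qed.

(** The automorphism permutes the facets and respects opposite pairs, which gives [p] and [e]. A
    face is determined by the facets that contain it, so nothing else is left to choose. *)
Lemma cube_autP q (a : cube q -> cube q) : poset_iso a ->
  exists (e : 'I_q -> bool) (p : 'S_q), a = cube_act e p.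
Proof.
move=> a_iso; have ma := a_iso.2.
have inj_a := mono_le_inj ma.
have [t at_] : exists t : 'I_q * bool -> 'I_q * bool,
    forall u, a (facet u.1 u.2) = facet (t u).1 (t u).2.
  suff /choice[t] : forall u : 'I_q * bool, exists v : 'I_q * bool,
      a (facet u.1 u.2) = facet v.1 v.2 by exists t.
  move=> u.
  by have [j [c jc]] := facet_auto u.1 u.2 a_iso; exists (j, c).
have facet_inj i j b c : @facet q i b = facet j c -> i = j /\ b = c.
  move=> /(congr1 (@^~ i)); rewrite /facet eqxx.
  by case: eqP => // -> [->].
have tN i : t (i, false) = ((t (i, true)).1, ~~ (t (i, true)).2).
  have [eq1|neq1] := eqVneq (t (i, false)).1 (t (i, true)).1.
    rewrite [LHS]surjective_pairing eq1; congr (_, _).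
    have [eq2|] := eqVneq (t (i, false)).2 (t (i, true)).2; last first.
      by case: (_.2) => //; case: (_.2).
    have := at_ (i, false); rewrite eq1 eq2 -at_ => /inj_a/facet_inj[_] //.
  (* If two opposite facets went to facets in different directions, the images would share the face
     [F]. The preimage of [F] would then lie on both opposite facets, which is impossible. *)
  pose F : cube q := fun j => if j == (t (i, false)).1 then Some (t (i, false)).2
    else if j == (t (i, true)).1 then Some (t (i, true)).2 else None.
  have [a' [_ aK a'K]] := iso_can a_iso.
  have : F <= facet (t (i, false)).1 (t (i, false)).2.
    by rewrite le_facet /F eqxx.
  rewrite -at_ -(a'K F) ma le_facet /= => /eqP F0.
  have : F <= facet (t (i, true)).1 (t (i, true)).2.
    by rewrite le_facet /F [X in if X then _ else _]eq_sym (negPf neq1) eqxx.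
  by rewrite -at_ -(a'K F) ma le_facet /= F0.
pose s i := (t (i, true)).1; pose e i := ~~ (t (i, true)).2.
have tE i b : t (i, b) = (s i, e i (+) b).
  by rewrite /s /e; case: b; rewrite ?tN ?addbT ?negbK ?addbF -?surjective_pairing.
have inj_s : injective s.
  move=> i j sij; have [h] : i = j /\ true = e j (+) (e i (+) true); last by [].
  by apply: facet_inj; apply: inj_a; rewrite (at_ (_, _)) (at_ (_, _)) !tE sij;
    rewrite /= addbA addbb.
have key F i b : (a F) (s i) = Some (e i (+) b) <-> F i = Some b.
  split=> /eqP; rewrite -le_facet => le; apply/eqP; rewrite -le_facet.
    by rewrite -ma (at_ (_, _)) tE.
  by move: le; rewrite -ma (at_ (_, _)) tE.
pose p := perm inj_s.
exists (fun i => e (p^-1 i)%g), (p^-1)%g; apply/funext => F; apply/funext => i.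
have {1}-> : i = s (p^-1 i)%g by rewrite -[s _](permE inj_s) permKV.
rewrite /cube_act; case Fi: (F _) => [b|] /=; first exact/key.
case aFi: (a F _) => [d|] //; move: Fi.
by rewrite ((key _ _ (e ((p^-1)%g i) (+) d)).1) // addbA addbb.
Qed.

(** The faces of [F] arise by filling in its free coordinates. The enumeration [f] of these is left
    open so that [lift i] can serve for a facet, where explicit coordinates are needed later. *)
Lemma chart_face q m (F : cube q) (f : 'I_m -> 'I_q) : injective f ->
    (forall i, F i = None <-> exists j, f j = i) ->
  exists2 T : cube m -> cube q, chart F T & forall G j, T G (f j) = G j.
Proof.
move=> inj_f fF.
pose T (G : cube m) : cube q :=
  fun i => if [pick j | f j == i] is Some j then G j else F i.
have TfE G j : T G (f j) = G j.
  rewrite /T; case: pickP => [l /eqP/inj_f->|/(_ j)] //.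
  by rewrite eqxx.
have TE G i b : F i = Some b -> T G i = Some b.
  move=> Fi; rewrite /T; case: pickP => // j /eqP fj.
  by have := (fF i).2 (ex_intro _ _ fj); rewrite Fi.
have TP (P : 'I_q -> Prop) : (forall j, P (f j)) ->
    (forall i b, F i = Some b -> P i) -> forall i, P i.
  move=> Pf PF i; case Fi: (F i) => [b|]; first exact: PF Fi.
  by have [j <-] := (fF i).1 Fi.
exists T => //; split=> [G H|G].
  apply/cube_leP/cube_leP => [GH j b Hj|GH].
    by rewrite -TfE; apply: GH; rewrite TfE.
  by apply: TP => [j b|i b Fi c]; rewrite ?TfE ?(TE _ _ _ Fi) //; apply: GH.
split=> [/cube_leP GF|[H <-]]; last first.
  by apply/cube_leP => i b Fi; rewrite (TE _ _ _ Fi).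
exists (G \o f); apply/funext; apply: TP => [j|i b Fi]; rewrite ?TfE //.
by rewrite (TE _ _ _ Fi) (GF _ _ Fi).
Qed.

Definition face_dim q (F : cube q) : nat := #|[pred i | F i == None]|.

Lemma chart_face_dim q (F : cube q) :
  exists T : cube (face_dim F) -> cube q, chart F T.
Proof.
have [||T T_chart _] := @chart_face q _ F (@enum_val _ [pred i | F i == None]).
- exact: enum_val_inj.
- move=> i; split=> [Fi|[j <-]]; last by apply/eqP; have := enum_valP j.
  by have Ai : i \in [pred i | F i == None]; [exact/eqP|
    exists (enum_rank_in Ai i); rewrite enum_rankK_in].
by exists T.
Qed.

Lemma has_dim_le d (P : porderType d) q (x y : P) :
  has_dim q x -> y <= x -> exists2 r, (r <= q)%N & has_dim r y.
Proof.
move=> /has_dimP[T T_chart] /(T_chart.2 _).1[F <-].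
have [S S_chart] := chart_face_dim F.
exists (face_dim F); first by rewrite -[leqRHS]card_ord max_card.
by apply/has_dimP; exists (T \o S); apply: chart_comp T_chart S_chart.
Qed.

Lemma has_dim_face q (F : cube q) : has_dim (face_dim F) F.
Proof. exact/has_dimP/chart_face_dim. Qed.

(** A [q]-cube has [3 ^ q] faces, so the number of faces determines the dimension. *)
Lemma has_dim_uniq d (P : porderType d) q r (x : P) :
  has_dim q x -> has_dim r x -> q = r.
Proof.
wlog: q r / (r <= q)%N => [wl qx rx|].
  by case/orP: (leq_total q r) => le; [apply/esym|]; apply: wl.
move=> rq [phi [bphi _]] [psi [[psi' _ psiK] _]].
apply/eqP; rewrite eqn_leq rq andbT.
pose h (F : {ffun 'I_q -> iface}) : {ffun 'I_r -> option bool} :=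
  [ffun i => psi' (phi F) i].
have inj_h : injective h.
  move=> F G /ffunP hFG; apply/ffunP => i.
  suff /(congr1 (@^~ i)) : (F : cube q) = G by [].
  apply: (bij_inj bphi); apply: (can_inj psiK); apply/funext => j.
  by have := hFG j; rewrite !ffunE.
have := leq_card h inj_h.
by rewrite !card_ffun !card_ord card_option card_bool leq_exp2l.
Qed.

End Cubes.

(** * The parity colouring pulled back from the grid *)

Section Colouring.
Local Open Scope order_scope.

(** On a vertex this is the parity of the coordinate sum. On other cells the lower end of each
    interval stands in for the coordinate. *)
Definition colour n (x : grid n) : bool :=
  \big[addb/false]_(i < n) odd `|(x i).1|%N.

Definition grid_end n (x : grid n) (j : 'I_n) (c : bool) : grid n :=
  fun i => if i == j then (((x j).1 + c%:Z)%R, false) else x i.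

Lemma grid_end_le n (x : grid n) j c : (x j).2 -> grid_end x j c <= x.
Proof.
move=> xj; apply/lefP => i; rewrite /grid_end; case: eqP => // ->.
rewrite /Order.le /= /line_le /= xj addr0 lerDl lerD2l.
by case: c.
Qed.

Lemma grid_end_neq n (x : grid n) j c : (x j).2 -> grid_end x j c <> x.
Proof.
by move=> xj /(congr1 (@^~ j)); rewrite /grid_end eqxx => /(congr1 snd); rewrite /= xj.
Qed.

Lemma odd_absz_add1 (z : int) : odd `|(z + 1)%R|%N = ~~ odd `|z|%N.
Proof.
case: z => [m|[|m]] //; first by rewrite -PoszD addn1.
by rewrite NegzE -[m.+2]addn1 PoszD opprD addrNK -opprD -PoszD !abszN !absz_nat addn1 /= negbK.
Qed.

Lemma colour_grid_end n (x : grid n) j :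
  colour (grid_end x j true) = ~~ colour (grid_end x j false).
Proof.
rewrite /colour (bigD1 j) //= [X in ~~ X](bigD1 j) //= /grid_end eqxx /=.
rewrite addr0 odd_absz_add1 -addNb; congr addb.
by apply: eq_bigr => i /negPf ->.
Qed.

Lemma grid_vertex_min n (x y : grid n) :
  (forall j, (x j).2 = false) -> y <= x -> y = x.
Proof.
move=> xv /lefP yx; apply/funext => j; have := yx j; have := xv j.
case: (x j) (y j) => [a b] [c e] /= -> /andP[/= ac]; rewrite addr0 => ca.
have ca' : (c <= a)%R by apply: le_trans ca; rewrite lerDl; case: (e).
have eac : a = c by apply/le_anti; rewrite ac ca'.
by move: ca; rewrite eac gerDl; case: (e).
Qed.

(** The cell [f x] extends in some direction [j]. Its two ends in that direction have opposite
    colours and must be [f a] and [f b], since [f] restricts to an isomorphism below [x]. *)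
Lemma colour_edge d (K : porderType d) k n (f : K -> skeleton k (grid n))
    (x a b : K) : nondegenerate_map f -> a <= x -> b <= x -> a <> x -> a <> b ->
  (forall y, y <= x -> [\/ y = x, y = a | y = b]) ->
  colour (val (f a)) = ~~ colour (val (f b)).
Proof.
move=> [_ /(_ x)[g [g_bij g_mono] gE]] ax bx a_x a_b xab.
have [g' _ g'K] := g_bij.
(* Otherwise [f x] is a vertex of the grid, hence minimal, and [a] and [x] have the same image. *)
have [j xj] : exists j, (val (f x) j).2.
  apply: contrapT => nx; apply: a_x.
  pose u : lower x := elem (ax : lower x a).
  pose v : lower x := elem (lexx x : lower x x).
  suff : u = v by move=> /(congr1 val).
  apply: (bij_inj g_bij); apply/val_inj/val_inj; rewrite !gE /=.
  apply: grid_vertex_min => [j|].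
    by apply/negbTE/negP => xj; apply: nx; exists j.
  have := set_valP (g u); rewrite /lower /= gE /= leEsub //.
(* Each end lies in the skeleton and strictly below [f x], so it comes from a proper face of [x]. *)
have end_f c : grid_end (val (f x)) j c = val (f a) \/
    grid_end (val (f x)) j c = val (f b).
  have le_end := @grid_end_le _ _ j c xj.
  have end_sk : skeleton k (grid n) (grid_end (val (f x)) j c).
    have [q qk fx_dim] := set_valP (f x).
    have [r rq r_dim] := has_dim_le fx_dim le_end.
    by exists r => //; apply: leq_trans qk.
  pose w : skeleton k (grid n) := elem end_sk.
  have wx : lower (f x) w by rewrite /lower /= leEsub.
  pose u := g' (elem wx).
  have : val (f (val u)) = grid_end (val (f x)) j c by rewrite -gE g'K.
  have [->|->|->] := xab _ (set_valP u); [|by left|by right].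
  by move=> /esym/grid_end_neq.
have col := colour_grid_end (val (f x)) j.
by case: (end_f true) (end_f false) col => -> [] -> => [|||];
  case: (colour _) (colour _) => [] [].
Qed.

End Colouring.

(** * Holonomy preserves colours, so its signs are even in number *)

Section Holonomy.
Local Open Scope order_scope.

Definition vertex q (v : 'I_q -> bool) : cube q := fun i => Some (v i).

Definition some_vertex q (F : cube q) : 'I_q -> bool := fun i => odflt false (F i).

Lemma some_vertex_le q (F : cube q) : vertex (some_vertex F) <= F.
Proof. by apply/cube_leP => i b Fi; rewrite /vertex /some_vertex Fi. Qed.

(** Induction on the number of true coordinates: switching one of them off flips [h]. *)
Lemma alternating_parity q (h : ('I_q -> bool) -> bool) :
    (forall (v : 'I_q -> bool) i, v i -> h v = ~~ h (fun j => (j != i) && v j)) ->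
  forall v, h v = h (fun=> false) (+) odd #|[pred i | v i]|.
Proof.
move=> h_alt v; move Em: #|_| => m; elim: m v Em => [|m IH] v Em.
  rewrite addbF; congr h; apply/funext => i; apply/negP => vi.
  by have := card0_eq Em i; rewrite !inE vi.
have [i vi] : exists i, v i.
  have [i vi|v0] := pickP [pred i | v i]; first by exists i.
  by move: Em; rewrite (eq_card0 v0).
rewrite (h_alt _ _ vi) IH ?addbN //.
by move: Em; rewrite (cardD1 i) inE vi => -[<-]; apply: eq_card => j.
Qed.

(* The last hypothesis says that [x] is an edge with end points [a] and [b]. *)
Definition proper_colouring d (K : porderType d) (col : K -> bool) : Prop :=
  forall x a b, a <= x -> b <= x -> a <> x -> a <> b ->
    (forall y, y <= x -> [\/ y = x, y = a | y = b]) -> col a = ~~ col b.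

Lemma colour_vertex d (K : porderType d) (col : K -> bool) q (x : K)
    (T : cube q -> K) : proper_colouring col -> chart x T ->
  forall v, col (T (vertex v)) =
    col (T (vertex (fun=> false))) (+) odd #|[pred i | v i]|.
Proof.
move=> col_proper T_chart.
have [mT imT] := T_chart; have inj_T := mono_le_inj mT.
apply: (@alternating_parity _ (fun v => col (T (vertex v)))) => v i vi.
pose v' j := (j != i) && v j.
(* The edge joining the vertices [v] and [v']; its image under [T] is the edge to which the
   colouring condition applies. *)
pose E : cube q := fun j => if j == i then None else Some (v j).
apply: (col_proper (T E)).
- by rewrite mT; apply/cube_leP => j b; rewrite /E; case: eqP.
- by rewrite mT; apply/cube_leP => j b; rewrite /E /vertex; case: eqP.
- by move=> /inj_T/(congr1 (@^~ i)); rewrite /E eqxx.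
- by move=> /inj_T/(congr1 (@^~ i)); rewrite /vertex eqxx vi.
move=> y yE; have [|F TF] := (imT y).1.
  by apply: le_trans yE _; apply/imT; exists E.
move: yE; rewrite -TF mT => /cube_leP FE.
have Fj j : j != i -> F j = Some (v j).
  by move=> ji; apply: FE; rewrite /E (negPf ji).
case Fi: (F i) => [[]|]; [apply: Or32|apply: Or33|apply: Or31]; congr T;
  apply/funext => j; rewrite /E /vertex; case: (eqVneq j i) => [->|/Fj->] //.
by rewrite Fi vi.
Qed.

(** In the charts [phi] of [s] and [g \o phi] of [t], both colourings are a constant plus the same
    parity. A vertex of the common face is fixed, so the constants agree. Minimality of [u]
    expresses that it is a vertex. *)
Lemma colour_elementary d (K : porderType d) (col : K -> bool) k (s t : K)
    (g : lower s -> lower t) : proper_colouring col -> has_dim k s ->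
    elementary k g -> forall u : lower s, (forall y, y <= val u -> y = val u) ->
  col (val (g u)) = col (val u).
Proof.
move=> col_proper [phi phi_iso] [g_iso [delta [_ delta_s _ g_delta]]] u u_min.
have col_s := colour_vertex col_proper (iso_chart phi_iso).
have col_t := colour_vertex col_proper (iso_chart (iso_comp g_iso phi_iso)).
have [phi' [_ _ phi'K]] := iso_can phi_iso.
have phi_min (w : lower s) : val (phi (vertex (some_vertex (phi' w)))) <= val w.
  by rewrite -{2}(phi'K w) -leEsub (phi_iso.2); apply: some_vertex_le.
pose w : lower s := elem (delta_s : lower s delta).
have := g_delta _ (phi_min w) => /(congr1 col).
rewrite -[val (phi _)]/((val \o phi) _) col_s.
rewrite -[val (g _)]/((val \o (g \o phi)) _) col_t => /addIb eq0.
have -> : u = phi (vertex (some_vertex (phi' u))).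
  by apply/val_inj/esym/u_min/phi_min.
rewrite -[val (phi _)]/((val \o phi) _) col_s.
by rewrite -[val (g _)]/((val \o (g \o phi)) _) col_t eq0.
Qed.

Lemma colour_morphism d (K : porderType d) (col : K -> bool) k (s t : K)
    (g : lower s -> lower t) : proper_colouring col -> groupoid_morphism k g ->
  [/\ has_dim k t, poset_iso g &
    forall u : lower s, (forall y, y <= val u -> y = val u) ->
      col (val (g u)) = col (val u)].
Proof.
move=> col_proper; elim=> {t g} [s_dim|t t' g h _ [t_dim g_iso g_col] t'_dim h_el].
  by split=> //; split=> //; exists id.
split=> // [|u u_min]; first exact: iso_comp h_el.1 g_iso.
rewrite /= -g_col //; apply: colour_elementary h_el _ _ => // y y_gu.
have yt : lower t y by apply: le_trans y_gu (set_valP (g u)).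
have [g' [_ gK g'K]] := iso_can g_iso.
(* The image of a vertex is a vertex: a cell below [g u] pulls back to one below the minimal [u]. *)
have : g' (elem yt) <= u by rewrite -g_iso.2 g'K leEsub.
by rewrite leEsub => /u_min/val_inj <-; rewrite g'K.
Qed.

(** Read through [phi], [g] is a signed permutation taking the vertex 0 to the vertex [e]. Their
    colours differ by the parity of [e], while [g] preserves colours. *)
Lemma holonomy_colour d (K : porderType d) (col : K -> bool) k (s : K)
    (phi : cube k -> lower s) (g : lower s -> lower s) :
    proper_colouring col -> poset_iso phi -> holonomy k s g ->
  exists (e : 'I_k -> bool) (p : 'S_k),
    ~~ odd #|[pred i | e i]| /\ forall F, g (phi F) = phi (cube_act e p F).
Proof.
move=> col_proper phi_iso /(colour_morphism col_proper)[_ g_iso g_col].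
have [phi' [phi'_iso phiK phi'K]] := iso_can phi_iso.
have [e [p aE]] := cube_autP (iso_comp phi'_iso (iso_comp g_iso phi_iso)).
have gE F : g (phi F) = phi (cube_act e p F) by rewrite -aE /= phi'K.
exists e, p; split=> //.
have phi_min v : forall y, y <= val (phi (vertex v)) -> y = val (phi (vertex v)).
  move=> y y_v; have ys : lower s y by apply: le_trans y_v (set_valP (phi (vertex v))).
  have : elem ys <= phi (vertex v) by rewrite leEsub.
  rewrite -[elem ys]phi'K (phi_iso.2) => /cube_leP le.
  have phi'y : phi' (elem ys) = vertex v by apply/funext => i; apply: le.
  by rewrite -phi'y phi'K.
have := g_col _ (phi_min (fun=> false)); rewrite gE.
have -> : cube_act e p (vertex (fun=> false)) = vertex e.
  by apply/funext => i; rewrite /cube_act /vertex /= addbF.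
rewrite -[val (phi _)]/((val \o phi) _).
rewrite (colour_vertex col_proper (iso_chart phi_iso)) /=.
by case: (col _) (odd _) => [] [].
Qed.

End Holonomy.

(** * Signed permutation matrices and their action on barycentres *)

Section Matrices.
Local Open Scope ring_scope.

Definition signed_mx k (e : 'I_k -> bool) (p : 'S_k) : 'M[int]_k :=
  diag_mx (\row_i (-1) ^+ e i) *m perm_mx p.

Lemma signed_mxE k (e : 'I_k -> bool) (p : 'S_k) i j :
  signed_mx e p i j = (-1) ^+ e i *+ (p i == j).
Proof. by rewrite /signed_mx mul_diag_mx !mxE mulr_natr. Qed.

Lemma barycentre_cube_act k (e : 'I_k -> bool) (p : 'S_k) (F : cube k) :
  barycentre (cube_act e p F) = signed_mx e p *m barycentre F.
Proof.
apply/matrixP => i j; rewrite !mxE (bigD1 (p i)) //= big1 => [|l /negPf pl].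
  by rewrite signed_mxE eqxx !mxE addr0 /cube_act; case: (F _) (e i) => [[]|] [].
by rewrite signed_mxE eq_sym pl mul0r.
Qed.

Lemma barycentre_inj k : injective (@barycentre k).
Proof.
move=> F G /matrixP FG; apply/funext => i; have := FG i ord0; rewrite !mxE.
by case: (F i) (G i) => [[]|] [[]|].
Qed.

Lemma barycentre_facet k (i : 'I_k) :
  barycentre (facet i true) = delta_mx i ord0.
Proof.
by apply/matrixP => j l; rewrite !mxE /facet ord1 andbT; case: eqP.
Qed.

Lemma card_signed_mx k (e : 'I_k -> bool) (p : 'S_k) :
  #|[pred ij : 'I_k * 'I_k | signed_mx e p ij.1 ij.2 == -1]| =
    #|[pred i | e i]|.
Proof.
rewrite -(card_image (f := fun i => (i, p i))) => [|i j [] //].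
apply: eq_card => -[i j]; rewrite inE /= signed_mxE.
apply/idP/mapP => [|[l]]; last first.
  by rewrite mem_enum inE => el [-> ->]; rewrite eqxx el.
by case: (p i =P j) => // <-; case ei: (e i) => // _; exists i => //; rewrite mem_enum.
Qed.

Lemma signed_mx_even k (e : 'I_k -> bool) (p : 'S_k) :
  ~~ odd #|[pred i | e i]| -> BC_even k (signed_mx e p).
Proof. by move=> e_even; split; [exists e, p|rewrite card_signed_mx]. Qed.

Lemma symmetry_signed_mx d (K : porderType d) k (s : K)
    (phi : cube k -> lower s) (g : lower s -> lower s) e (p : 'S_k) :
    poset_iso phi -> (forall F, g (phi F) = phi (cube_act e p F)) ->
  symmetry_mx phi g (signed_mx e p).
Proof.
by move=> phi_iso gE F G; rewrite gE => /(bij_inj phi_iso.1)<-;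
  apply: barycentre_cube_act.
Qed.

Lemma symmetry_mx_uniq d (K : porderType d) k (s : K)
    (phi : cube k -> lower s) (g : lower s -> lower s) A B : poset_iso phi ->
  symmetry_mx phi g A -> symmetry_mx phi g B -> A = B.
Proof.
move=> phi_iso gA gB; have [phi' [_ _ phi'K]] := iso_can phi_iso.
have col_eq i : A *m delta_mx i ord0 = B *m delta_mx i ord0 :> 'cV_k.
  have gi : g (phi (facet i true)) = phi (phi' (g (phi (facet i true)))).
    by rewrite phi'K.
  by rewrite -barycentre_facet -(gA _ _ gi) -(gB _ _ gi).
apply/matrixP => i j; have /(congr1 (fun v : 'cV_k => v i ord0)) := col_eq j.
by rewrite -!colE !mxE.
Qed.

End Matrices.

(** * The boundary of a cube inside [K], and loops of facets *)

Section Boundary.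
Local Open Scope order_scope.

Definition cube_top q : cube q := fun=> None.
Arguments cube_top : clear implicits.

(** [T] is total on the cube, but both clauses constrain it only away from the top cell. It thus
    embeds the boundary sphere onto a downward closed set of cells. *)
Definition boundary_embedding d (K : porderType d) q (T : cube q -> K) : Prop :=
  (forall F G, F <> cube_top q -> G <> cube_top q -> (T F <= T G) = (F <= G)) /\
  (forall F y, F <> cube_top q -> y <= T F ->
     exists2 G, G <> cube_top q & T G = y).

Lemma not_top q (F : cube q) i : F i <> None -> F <> cube_top q.
Proof. by move=> Fi /(congr1 (@^~ i)). Qed.

Lemma le_not_top q (F G : cube q) :
  F <= G -> G <> cube_top q -> F <> cube_top q.
Proof.
move=> /cube_leP FG G_top F_top; apply/G_top/funext => i.
by case Gi: (G i) => [b|//]; move: (FG _ _ Gi); rewrite F_top.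
Qed.

Lemma boundary_chart d (K : porderType d) q (T : cube q -> K) d'
    (Q : porderType d') (F : cube q) (S : Q -> cube q) :
  boundary_embedding T -> F <> cube_top q -> chart F S -> chart (T F) (T \o S).
Proof.
move=> [mT imT] F_top [mS imS].
have S_top G : S G <> cube_top q.
  by apply: le_not_top F_top; apply/imS; exists G.
split=> [G H|y]; first by rewrite /= mT // mS.
split=> [yF|[G <-]]; last by rewrite mT //; apply/imS; exists G.
have [G G_top TG] := imT _ _ F_top yF.
by move: yF; rewrite -TG mT // => /imS[H <-]; exists H.
Qed.

Lemma boundary_has_dim d (K : porderType d) q (T : cube q -> K) F :
  boundary_embedding T -> F <> cube_top q -> has_dim (face_dim F) (T F).
Proof.
move=> T_bd F_top; have [S S_chart] := chart_face_dim F.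
by apply/has_dimP; exists (T \o S); apply: boundary_chart.
Qed.

(** The top cell has dimension [q.+1], and any other cell has a fixed coordinate, hence at most [q]
    free ones. *)
Lemma boundary_skeleton q (F : cube q.+1) :
  skeleton q (cube q.+1) F <-> F <> cube_top q.+1.
Proof.
split=> [[r rq r_dim] F_top|F_top].
  have := has_dim_uniq r_dim (has_dim_face F).
  rewrite F_top /face_dim (eq_card (B := 'I_q.+1)) ?card_ord => [re|i]; last by rewrite !inE.
  by move: rq; rewrite re ltnn.
exists (face_dim F); last exact: has_dim_face.
rewrite -ltnS -[X in (_ < X)%N](card_ord q.+1); apply: proper_card.
apply/fintype.properP; split; first exact/fintype.subsetP.
have [i Fi] : exists i, F i <> None.
  by apply: contrapT => nF; apply/F_top/funext => i; apply: contrapT => Fi; apply: nF; exists i.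
by exists i => //; rewrite inE; apply/eqP.
Qed.

Lemma subcomplex_boundary d (K : porderType d) q (L : set K) (x : K) :
    subcomplex L -> L x -> isomorphic (skeleton q (cube q.+1)) L ->
  exists2 T : cube q.+1 -> K, boundary_embedding T &
    exists2 F, F <> cube_top q.+1 & T F = x.
Proof.
move=> L_sub Lx [psi [[psi' psiK psi'K] psi_mono]].
(* The value [x] at the top cell is an arbitrary default. *)
pose T F := if pselect (skeleton q (cube q.+1) F) is left sF
  then val (psi (elem sF)) else x.
have TE (u : skeleton q (cube q.+1)) : T (val u) = val (psi u).
  rewrite /T; case: pselect => [sF|]; first by congr (val (psi _)); apply/val_inj.
  by case; apply: set_valP.
have imT y : L y -> exists2 G, G <> cube_top q.+1 & T G = y.
  move=> Ly; exists (val (psi' (elem Ly))); first exact/boundary_skeleton/set_valP.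
  by rewrite TE psi'K.
exists T; last exact: imT.
split=> [F G /boundary_skeleton sF /boundary_skeleton sG|F y /boundary_skeleton sF].
  rewrite -[F]/(val (elem sF)) -[G]/(val (elem sG)) !TE -!leEsub.
  exact: psi_mono.
rewrite -[F]/(val (elem sF)) TE => yF; apply: imT; apply: L_sub yF _.
exact: set_valP.
Qed.

(** If [S] is a chart of [F], then [a \o S] is a chart of [G]. Composing both with [T] and comparing
    them gives the isomorphism. *)
Lemma boundary_transport d (K : porderType d) q (T : cube q -> K)
    (a : cube q -> cube q) (F G : cube q) :
    boundary_embedding T -> F <> cube_top q -> G <> cube_top q ->
    poset_iso a -> a F = G ->
  exists2 g : lower (T F) -> lower (T G), poset_iso g &
    forall u X, X <= F -> val u = T X -> val (g u) = T (a X).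
Proof.
move=> T_bd F_top G_top a_iso aF.
have [S S_chart] := chart_face_dim F.
have a_chart : chart G (a \o S).
  split=> [X Y|Y]; first by rewrite /= a_iso.2 S_chart.1.
  have [a' [_ _ a'K]] := iso_can a_iso.
  rewrite -aF -(a'K Y) a_iso.2 S_chart.2.
  split=> [[X <-]|[X /(bij_inj a_iso.1) <-]]; by exists X.
have [phi phi_iso phiE] := chart_iso (boundary_chart T_bd F_top S_chart).
have [psi psi_iso psiE] := chart_iso (boundary_chart T_bd G_top a_chart).
have [phi' [phi'_iso phiK phi'K]] := iso_can phi_iso.
exists (psi \o phi'); first exact: iso_comp.
move=> u X /(S_chart.2 _).1[Y <-] uE.
have -> : u = phi Y by apply/val_inj; rewrite phiE uE.
by rewrite /= phiK psiE.
Qed.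

(* The elementary morphism between the facets [x_i = b] and [x_j = c] of a cube
   is the restriction of this symmetry of the whole cube. *)
Definition facet_swap q (i j : 'I_q) (b c : bool) : cube q -> cube q :=
  cube_act (fun l => ((l == i) || (l == j)) && (b (+) c)) (tperm i j).

Lemma facet_swapL q (i j : 'I_q) b c X :
  facet_swap i j b c X i = omap (addb (b (+) c)) (X j).
Proof. by rewrite /facet_swap /cube_act tpermL eqxx. Qed.

Lemma facet_swapR q (i j : 'I_q) b c X :
  facet_swap i j b c X j = omap (addb (b (+) c)) (X i).
Proof. by rewrite /facet_swap /cube_act tpermR eqxx orbT. Qed.

Lemma facet_swapD q (i j l : 'I_q) b c X :
  l != i -> l != j -> facet_swap i j b c X l = X l.
Proof.
move=> li lj; rewrite /facet_swap /cube_act tpermD ?[_ == l]eq_sym //.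
by rewrite (negPf li) (negPf lj); case: (X l).
Qed.

Lemma facet_swap_facet q (i j : 'I_q) b c :
  i != j -> facet_swap i j b c (facet i b) = facet j c.
Proof.
move=> ij; apply/funext => l; rewrite [RHS]/facet.
have [->|lj] := eqVneq l j; first by rewrite facet_swapR /facet eqxx /= addbAC addbb.
have [->|li] := eqVneq l i.
  by rewrite facet_swapL /facet eq_sym (negPf ij).
by rewrite facet_swapD // /facet (negPf li).
Qed.

(** For distinct [i] and [j], the intersection of the facets [x_i = b] and [x_j = c]. It is the
    common face fixed by the elementary morphism between them. *)
Definition ridge q (i j : 'I_q) (b c : bool) : cube q :=
  fun l => if l == i then Some b else facet j c l.

Lemma le_ridge q (X : cube q) (i j : 'I_q) b c : i != j ->
  (X <= ridge i j b c) = (X i == Some b) && (X j == Some c).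
Proof.
move=> ij; apply/cube_leP/andP => [XR|[/eqP Xi /eqP Xj] l e].
  by split; apply/eqP/XR; rewrite /ridge /facet ?eqxx // eq_sym (negPf ij).
by rewrite /ridge /facet; case: eqP => [->|_]; [|case: eqP => // ->]; move=> <-.
Qed.

(** The flip by [b (+) c] compensates for exchanging the fixed values [b] and [c]. *)
Lemma facet_swap_ridge q (X : cube q) (i j : 'I_q) b c : i != j ->
  X <= ridge i j b c -> facet_swap i j b c X = X.
Proof.
move=> ij; rewrite le_ridge // => /andP[/eqP Xi /eqP Xj]; apply/funext => l.
have [->|li] := eqVneq l i; first by rewrite facet_swapL Xi Xj /= -addbA addbb addbF.
have [->|lj] := eqVneq l j; first by rewrite facet_swapR Xi Xj /= addbAC addbb.
exact: facet_swapD.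
Qed.

Lemma facet_not_top q (i : 'I_q) b : facet i b <> cube_top q.
Proof. by apply: (@not_top _ _ i); rewrite /facet eqxx. Qed.

Lemma face_dim_facet q (i : 'I_q.+1) b : face_dim (facet i b) = q.
Proof.
rewrite /face_dim (eq_card (B := predC1 i)) => [|l].
  by rewrite cardC1 card_ord.
by rewrite !inE /facet; case: (l =P i).
Qed.

Lemma face_dim_eq_facet q (F : cube q.+1) :
  face_dim F = q -> exists i b, F = facet i b.
Proof.
move=> F_dim; have : #|predC [pred i | F i == None]| = 1%N.
  by apply/eqP; rewrite -(eqn_add2l q) -{1}F_dim cardC card_ord addn1.
case/mem_card1 => i iP.
have FN j : (F j == None) = (j != i) by rewrite -[j == i]iP negbK.
case Fi: (F i) => [b|]; last by have := FN i; rewrite Fi !eqxx.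
exists i, b; apply/funext => j; rewrite /facet.
by have [->|ji] := eqVneq j i => //; apply/eqP; rewrite FN.
Qed.

Lemma face_dim_ridge q (i j : 'I_q.+1) b c : i != j ->
  face_dim (ridge i j b c) = q.-1.
Proof.
move=> ij; have := cardC (pred2 i j); rewrite card2 ij card_ord => /eqP.
rewrite add2n eqSS => /eqP/(congr1 predn) /= q1.
rewrite -[RHS]q1; apply: eq_card => l.
by rewrite !inE /ridge /facet; case: (l =P i) => //=; case: (l =P j).
Qed.

Lemma facet_elementary d (K : porderType d) k (T : cube k.+1 -> K)
    (i j : 'I_k.+1) b c : boundary_embedding T -> i != j ->
  exists2 g : lower (T (facet i b)) -> lower (T (facet j c)), elementary k g &
    forall u X, X <= facet i b -> val u = T X ->
      val (g u) = T (facet_swap i j b c X).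
Proof.
move=> T_bd ij; have top := @facet_not_top k.+1.
have swap_iso : poset_iso (facet_swap i j b c) by apply: cube_act_iso.
have [g g_iso gE] := boundary_transport T_bd (top i b) (top j c) swap_iso
  (facet_swap_facet b c ij).
exists g => //; split=> //.
have R_top : ridge i j b c <> cube_top k.+1.
  by apply: (@not_top _ _ i); rewrite /ridge eqxx.
have [Ri Rj] : ridge i j b c <= facet i b /\ ridge i j b c <= facet j c.
  have := lexx (ridge i j b c); rewrite le_ridge // => /andP[Ri Rj].
  by rewrite !le_facet.
exists (T (ridge i j b c)); split; rewrite ?T_bd.1 //.
  by rewrite -(face_dim_ridge b c ij); apply: boundary_has_dim.
move=> u uR; have [X X_top TX] := T_bd.2 _ _ R_top uR.
have XR : X <= ridge i j b c by rewrite -T_bd.1 // TX.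
by rewrite (gE _ X) ?facet_swap_ridge //; apply: le_trans Ri.
Qed.

Lemma groupoid_trans d (K : porderType d) k (s t r : K)
    (g : lower s -> lower t) (h : lower t -> lower r) :
  groupoid_morphism k g -> groupoid_morphism k h -> groupoid_morphism k (h \o g).
Proof.
move=> g_mor; elim=> {r h} // r r' h h' _ gh_mor r'_dim h'_el.
exact: groupoid_comp gh_mor r'_dim h'_el.
Qed.

(* The loop passes through the facets [x_i = c], [x_j = 0], [x_l = b]. *)
Lemma facet_loop d (K : porderType d) k (T : cube k.+1 -> K)
    (i j l : 'I_k.+1) b c : boundary_embedding T -> i != j -> j != l -> l != i ->
  exists2 g, holonomy k (T (facet i c)) g &
    forall u X, X <= facet i c -> val u = T X ->
      val (g u) = T (facet_swap l i b c (facet_swap j l false b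
        (facet_swap i j c false X))).
Proof.
move=> T_bd ij jl li.
have dimT m e : has_dim k (T (facet m e)).
  by rewrite -{1}(face_dim_facet m e); apply: boundary_has_dim (@facet_not_top _ _ _).
have [g1 g1_el g1E] := facet_elementary c false T_bd ij.
have [g2 g2_el g2E] := facet_elementary false b T_bd jl.
have [g3 g3_el g3E] := facet_elementary b c T_bd li.
exists (g3 \o (g2 \o (g1 \o id))).
  do 3?[apply: groupoid_comp => //]; exact: groupoid_id.
have swap_le (m m' : 'I_k.+1) e e' X : m != m' -> X <= facet m e ->
    facet_swap m m' e e' X <= facet m' e'.
  move=> mm'; rewrite -(facet_swap_facet e e' mm').
  by have [_ ->] : poset_iso (facet_swap m m' e e') by apply: cube_act_iso.
move=> u X Xi uX /=; apply: g3E; first exact: swap_le _ _ _ _ _ jl (swap_le _ _ _ _ _ ij Xi).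
apply: g2E; first exact: swap_le _ _ _ _ _ ij Xi.
exact: g1E.
Qed.

(** Slot [i] serves as temporary storage. The first swap puts [X_m], flipped by [c], into slot [i];
    the second puts [X_n], flipped by [b], into slot [m]; the third moves slot [i] into slot [n]
    with a flip by [b (+) c]. Both coordinates end up flipped by [b], and slot [i] holds [c]
    again. *)
Lemma facet_loopE k (i : 'I_k.+1) (m n : 'I_k) b c (X Y : cube k.+1) :
    m != n -> X i = Some c -> Y i = Some c ->
    (forall x, Y (lift i x) = cube_act
      (fun y => ((y == m) || (y == n)) && b) (tperm m n) (X \o lift i) x) ->
  facet_swap (lift i n) i b c (facet_swap (lift i m) (lift i n) false b
    (facet_swap i (lift i m) c false X)) = Y.
Proof.
move=> mn Xi Yi YE.
have inj := inj_eq (@lift_inj _ i).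
have li x : lift i x != i by rewrite eq_sym neq_lift.
have il x : i != lift i x by rewrite neq_lift.
apply/funext => l; case: (unliftP i l) => [x|] ->; last first.
  rewrite facet_swapR facet_swapR facet_swapR Xi Yi /=.
  by congr Some; case: (b) (c) => [] [].
have [->|xn] := eqVneq x n.
  rewrite facet_swapL facet_swapD // facet_swapL YE /cube_act tpermR eqxx orbT /=.
  by case: (X _) => //= e; rewrite -addbA [c (+) _]addbC; case: (b) (c) e => [] [] [].
have [->|xm] := eqVneq x m.
  rewrite facet_swapD ?inj // facet_swapL facet_swapD ?inj 1?eq_sym //.
  by rewrite YE /cube_act tpermL eqxx.
rewrite !facet_swapD ?inj // YE /cube_act tpermD ?[_ == x]eq_sym //.
by rewrite (negPf xn) (negPf xm) /=; case: (X _).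
Qed.

End Boundary.

(** * Generators of the even signed permutations *)

Section Generation.

(** Unsigned swaps generate all permutations. A swap with signs times the same swap without them
    flips two coordinates, and such flips generate the even sign vectors. *)
Lemma even_signed_perm_ind k (P : ('I_k -> bool) -> 'S_k -> Prop) :
    P (fun=> false) 1%g ->
    (forall e p e' p', P e p -> P e' p' ->
      P (fun i => e i (+) e' (p i)) (p * p')%g) ->
    (forall m n b, m != n ->
      P (fun i => ((i == m) || (i == n)) && b) (tperm m n)) ->
  forall e p, ~~ odd #|[pred i | e i]| -> P e p.
Proof.
move=> P1 PM Pswap e p e_even.
have P_perm : P (fun=> false) p.
  have [ts -> ] := prod_tpermP p; elim: ts => [|[m n] ts IH] /=.
    by rewrite big_nil.
  case/andP=> mn /IH Pts; rewrite big_cons.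
  have := PM _ _ _ _ (Pswap m n false mn) Pts.
  by congr P; apply/funext => i; rewrite andbF.
have P_flip m n : m != n -> P (fun i => (i == m) || (i == n)) 1%g.
  move=> mn; have := PM _ _ _ _ (Pswap m n false mn) (Pswap m n true mn).
  rewrite tperm2; congr P; apply/funext => i; rewrite andbF andbT /=.
  by case: tpermP => [->|->|/eqP/negPf-> /eqP/negPf->] //; rewrite !eqxx ?orbT.
suff Pe : P e 1%g.
  have := PM _ _ _ _ Pe P_perm; rewrite mul1g.
  by congr P; apply/funext => i; rewrite addbF.
(* Induction on the number of signs, removing two at a time. *)
move: e_even; have [m] := ubnP #|[pred i | e i]|; elim: m e => // m IH e em e_even.
have [i ei|e0] := pickP e; last first.
  suff -> : e = fun=> false by [].
  by apply/funext => i; rewrite e0.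
have ecard : #|[pred j | e j]| = #|[predD1 [pred j | e j] & i]|.+1.
  by rewrite (cardD1 i) inE ei.
(* A sign at [i] alone would make the number odd, so there is a second one at some [j]. *)
have [j /andP[/= ji ej]|e1] := pickP [predD1 [pred j | e j] & i]; last first.
  by move: e_even; rewrite ecard (eq_card0 e1).
have ecard2 : #|[predD1 [pred j | e j] & i]| =
    #|[pred l | e l && ~~ ((l == i) || (l == j))]|.+1.
  rewrite (cardD1 j) !inE ji (ej : e j); congr _.+1; apply: eq_card => l.
  by rewrite !inE negb_or; case: (l == j); case: (l == i); rewrite ?andbF ?andbT.
move: em e_even; rewrite ecard ecard2 /= negbK => em e_even.
have Pe := IH _ (leq_trans _ (ltnSE em)) e_even.
have ij : i != j by rewrite eq_sym.
have := PM _ _ _ _ (P_flip i j ij) (Pe _); rewrite mulg1 => Pe'.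
have -> : e = fun l => ((l == i) || (l == j)) (+)
    (e l && ~~ ((l == i) || (l == j))).
  apply/funext => l; case: eqP => [->|_]; first by rewrite ei.
  by case: eqP => [->|_]; rewrite ?(ej : e j) //= andbT.
by have := Pe' (leqnSn _); congr P; apply/funext => l; rewrite perm1.
Qed.

End Generation.

(** * Every even symmetry of a boundary facet is a holonomy *)

Section Realization.
Local Open Scope order_scope.

(** By its dimension [s] is the image of a facet [x_i = c]. In the coordinates given by [lift i],
    loops through two further facets realise the generators, and the holonomies are closed under
    composition. *)
Lemma boundary_realizes_even d (K : porderType d) k (s : K)
    (T : cube k.+1 -> K) (F : cube k.+1) : boundary_embedding T ->
    F <> @cube_top _ -> T F = s -> has_dim k s ->
  exists2 phi : cube k -> lower s, poset_iso phi &
    forall (e : 'I_k -> bool) (p : 'S_k), ~~ odd #|[pred i | e i]| ->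
    exists2 g, holonomy k s g & forall G, g (phi G) = phi (cube_act e p G).
Proof.
move=> T_bd F_top <- s_dim.
have [i [c Fi]] := face_dim_eq_facet
  (has_dim_uniq (boundary_has_dim T_bd F_top) s_dim).
rewrite {}Fi in F_top s_dim *.
have [||S S_chart SE] := @chart_face _ _ (facet i c) (lift i).
- exact: lift_inj.
- move=> j; rewrite /facet; split=> [|[l <-]]; last by rewrite eq_sym (negPf (neq_lift _ _)).
  by case: (unliftP i j) => [l ->|->]; [exists l|rewrite eqxx].
have [phi phi_iso phiE] := chart_iso (boundary_chart T_bd F_top S_chart).
have S_le G : S G <= facet i c by apply/S_chart.2; exists G.
exists phi => //; apply: even_signed_perm_ind.
- exists (fun u => u); first exact: groupoid_id.
  by move=> G; rewrite cube_act1.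
- move=> e p e' p' [g g_hol gE] [g' g'_hol g'E].
  exists (g \o g'); first exact: groupoid_trans g'_hol g_hol.
  by move=> G; rewrite /= g'E gE cube_act_comp.
move=> m n b mn.
have im : i != lift i m by rewrite neq_lift.
have ni : lift i n != i by rewrite eq_sym neq_lift.
have mn' : lift i m != lift i n by rewrite (inj_eq lift_inj).
have [g g_hol gE] := facet_loop b c T_bd im mn' ni.
exists g => // G; apply/val_inj; rewrite (gE _ (S G)) // phiE /=.
have Si H : S H i = Some c by apply/eqP; rewrite -le_facet.
congr T; apply: facet_loopE => // x.
by rewrite SE; congr cube_act; apply/funext => y; rewrite /= SE.
Qed.

End Realization.

Theorem theorem3p2 (d : Order.disp_t) (K : porderType d) (k n : nat)
    (k_gt0 : (0 < k)%N)
    (K_cubical : cubical K) (K_dim : dimensional k K)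
    (f : K -> skeleton k (grid n)) (f_nondeg : nondegenerate_map f)
    (sigma : K) (sigma_dim : has_dim k sigma) :
  (forall phi : cube k -> lower sigma, poset_iso phi ->
     holonomy k sigma `<=`
       [set g | exists2 A : 'M[int]_k, BC_even k A & symmetry_mx phi g A])
  /\
  (forall L : set K, subcomplex L -> L sigma ->
     isomorphic (skeleton k (cube k.+1)) L ->
     group_isomorphic (fun g h : lower sigma -> lower sigma => g \o h)
       (holonomy k sigma)
       (fun A B : 'M[int]_k => A *m B)%R (BC_even k)).
Proof.
have col_proper : proper_colouring (fun x => colour (val (f x))).
  by move=> x a b ax bx a_x a_b xab; apply: (@colour_edge _ _ _ _ _ x).
have even phi g : poset_iso phi -> holonomy k sigma g ->
    exists (e : 'I_k -> bool) (p : 'S_k), [/\ ~~ odd #|[pred i | e i]|,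
      forall F, g (phi F) = phi (cube_act e p F) &
      symmetry_mx phi g (signed_mx e p)].
  move=> phi_iso g_hol.
  have [e [p [e_even gE]]] := holonomy_colour col_proper phi_iso g_hol.
  by exists e, p; split=> //; apply: symmetry_signed_mx.
split=> [phi phi_iso g /(even phi g phi_iso)[e [p [e_even _ gA]]]|L L_sub Ls L_iso].
  by exists (signed_mx e p) => //; apply: signed_mx_even.
have [T T_bd [F F_top TF]] := subcomplex_boundary L_sub Ls L_iso.
have [phi phi_iso realize] := boundary_realizes_even T_bd F_top TF sigma_dim.
have [phi' [_ _ phi'K]] := iso_can phi_iso.
(* The default 0 is never taken on the holonomy group, where [even] supplies a matrix. *)
pose Phi g := xget 0%R (fun A => symmetry_mx phi g A).
have PhiE g A : symmetry_mx phi g A -> Phi g = A.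
  by move=> gA; apply: xget_unique => // B /symmetry_mx_uniq; apply.
exists Phi; first split.
- move=> g /(even _ _ phi_iso)[e [p [e_even _ /PhiE ->]]].
  exact: signed_mx_even.
(* Injectivity: equal matrices move barycentres alike, and a face is determined by its
   barycentre. *)
- move=> g h /set_mem/(even _ _ phi_iso)[e [p [_ gE /PhiE ->]]].
  move=> /set_mem/(even _ _ phi_iso)[e' [p' [_ hE /PhiE ->]]] eqA.
  apply/funext => u; rewrite -(phi'K u) gE hE; congr phi.
  by apply: barycentre_inj; rewrite !barycentre_cube_act eqA.
- move=> A [[e [p ->]]]; rewrite card_signed_mx => /(realize e p)[g g_hol gE].
  by exists g => //; apply/PhiE/symmetry_signed_mx.
move=> g h /(even _ _ phi_iso)[e [p [_ gE /PhiE ->]]].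
move=> /(even _ _ phi_iso)[e' [p' [_ hE /PhiE ->]]].
apply: PhiE => X Y /=; rewrite hE gE => /(bij_inj phi_iso.1) <-.
by rewrite !barycentre_cube_act mulmxA.
Qed.
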